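(* Let $d\ge 1$ be an integer and let $\lambda$ denote the Lebesgue measure on $\mathbb{R}^d$. There exists a translation invariant measure $\mu$ on $(\mathbb{R}^d,\mathcal{B}(\mathbb{R}^d))$ that is not equal to the Lebesgue measure $\lambda$ (on $\mathcal{B}(\mathbb{R}^d)$), but for which there exists a compact set $K\subset\mathbb{R}^d$ such that $0<\mu(K)=\lambda(K)<\infty$. Specifically, this measure satisfies $\mu([0,1]^d)=+\infty$.
   Context: $\mathcal{B}(\mathbb{R}^d)$ is the Borel $\sigma$-algebra on $\mathbb{R}^d$. Measures are countably additive with values in $[0,\infty]$ (no $\sigma$-finiteness or local finiteness is assumed). A measure $\mu$ on $\mathcal{B}(\mathbb{R}^d)$ is translation invariant if $\mu(B+x)=\mu(B)$ for all $B\in\mathcal{B}(\mathbb{R}^d)$ and $x\in\mathbb{R}^d$. *)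

(* Defs.v *)
(* R^d is 'rV[R]_d for R : realType, with the library's product topology and
   the Borel sigma-algebra. *)
From HB Require Import structures.
From mathcomp Require Import all_boot all_order all_algebra.
From mathcomp Require Import all_classical all_reals all_analysis.
From mathcomp Require Import measurable_realfun.

Set Implicit Arguments.
Unset Strict Implicit.
Unset Printing Implicit Defensive.

Import Order.TTheory GRing.Theory Num.Theory.
Import numFieldNormedType.Exports.

Local Open Scope classical_set_scope.
Local Open Scope ring_scope.

HB.instance Definition _ (R : realType) (m n : nat) :=
  @isMeasurable.Build (sigma_display (@open 'M[R]_(m, n))) 'M[R]_(m, n)
    <<s @open 'M[R]_(m, n) >> (@sigma_algebra0 _ setT _) (@sigma_algebraC _ _)
    (@sigma_algebra_bigcup _ setT _).

Definition rV_cons (R : realType) (d : nat) (p : R * 'rV[R]_d) : 'rV[R]_d.+1 :=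
  row_mx p.1%:M p.2.

(* The d-fold product of the library's one-dimensional Lebesgue measure, carried
   from R * R^d to R^(d+1) along rV_cons. The values outside the Borel sets are
   junk. It is a sigma-finite measure (section lebesgue_rV_measure), and
   lebesgue_rV_box gives its value on products of Borel sets. *)
Fixpoint lebesgue_rV (R : realType) (d : nat) : set 'rV[R]_d -> \bar R :=
  match d with
  | 0 => \d_(0 : 'rV[R]_0)
  | d'.+1 =>
      pushforward (@lebesgue_measure R \x @lebesgue_rV R d')%E (@rV_cons R d')
  end.

Section rV_Borel.
Variable R : realType.

Lemma measurable_coord d (j : 'I_d) :
  measurable_fun setT ((fun v => v 0 j) : 'rV[R]_d -> measurableTypeR R).
Proof.
apply: (measurability _ (RGenOpens.measurableE R)).
move=> _ [_ [a [b ->] <-]]; rewrite setTI; apply: sub_sigma_algebra.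
apply: open_comp; last exact: interval_open.
by move=> v _; exact: coord_continuous.
Qed.

Lemma open_rVE d (U : set 'rV[R]_d) : open U ->
  let box (q : {ffun 'I_d -> rat * rat}) : set 'rV[R]_d :=
    [set v | forall j, v 0 j \in `] (ratr (q j).1), (ratr (q j).2)[] in
  U = \bigcup_q (if `[< box q `<=` U >] then box q else set0).
Proof.
move=> oU box; apply/seteqP; split => [v Uv|v [q _]]; last first.
  by case: asboolP => // + bqv; exact.
have /= [P Pv PU] := oU _ Uv.
have /choice[q qP] (j : 'I_d) : exists q : rat * rat,
    (v 0 j \in `] (ratr q.1), (ratr q.2)[) /\
    `] (ratr q.1), (ratr q.2)[%classic `<=` P 0 j.
  have /nbhs_ballP[e /= e0 eP] := Pv 0 j.
  have /rat_in_itvoo[a] : v 0 j - e < v 0 j by rewrite ltrBlDr ltrDl.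
  have /rat_in_itvoo[b] : v 0 j < v 0 j + e by rewrite ltrDl.
  rewrite !in_itv /= => /andP[vb be] /andP[ea av]; exists (a, b).
  split => [|z]; rewrite /= in_itv /= ?av// => /andP[az zb]; apply: eP.
  by rewrite -ball_normE /ball_ /= distrC ltr_distl (lt_trans ea)// (lt_trans zb).
exists [ffun j => q j] => //.
have bqU : box [ffun j => q j] `<=` U.
  move=> w bqw; apply: PU => i j; rewrite ord1; apply: (qP j).2 => /=.
  by have := bqw j; rewrite ffunE.
by rewrite asboolT// => j; rewrite ffunE; exact: (qP j).1.
Qed.

Lemma measurable_fun_rV dT (T : measurableType dT) d (f : T -> 'rV[R]_d) :
  (forall j, measurable_fun setT ((fun t => f t 0 j) : T -> measurableTypeR R)) ->
  measurable_fun setT f.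
Proof.
move=> mf; apply: (@measurability _ _ _ _ _ _ (@open 'rV[R]_d)) => // _ [U oU <-].
rewrite setTI (open_rVE oU) preimage_bigcup.
apply: countable_bigcupT_measurable => // q; case: ifPn => _; last first.
  by rewrite preimage_set0.
rewrite (_ : _ @^-1` _ = \bigcap_(j : 'I_d)
    ((fun t => f t 0 j) @^-1` `] (ratr (q j).1), (ratr (q j).2)[)); last first.
  by apply/seteqP; split => t /= => [qt j _|qt j]; [exact: qt|exact: (qt j I)].
apply: fin_bigcap_measurable => // j _.
by rewrite -[X in measurable X]setTI; exact: mf.
Qed.

Lemma rV_cons0 d (p : R * 'rV[R]_d) : rV_cons p 0 ord0 = p.1.
Proof.
rewrite (_ : ord0 = lshift d (ord0 : 'I_1)); last exact: val_inj.
by rewrite (row_mxEl p.1%:M p.2) mxE eqxx.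
Qed.

Lemma rV_consS d (p : R * 'rV[R]_d) j : rV_cons p 0 (lift ord0 j) = p.2 0 j.
Proof.
by rewrite (_ : lift _ _ = rshift 1 j) ?(row_mxEr p.1%:M p.2)//; exact: val_inj.
Qed.

Lemma measurable_rV_cons d : measurable_fun setT
  (@rV_cons R d : measurableTypeR R * 'rV[R]_d -> 'rV[R]_d.+1).
Proof.
apply: measurable_fun_rV => j; have [k ->|->] := unliftP ord0 j.
  under eq_fun do rewrite rV_consS.
  by apply: (measurableT_comp (measurable_coord k)); exact: measurable_snd.
by under eq_fun do rewrite rV_cons0; exact: measurable_fst.
Qed.

Lemma measurable_rV_box d (A : 'I_d -> set (measurableTypeR R)) :
  (forall j, measurable (A j)) ->
  measurable [set v : 'rV[R]_d | forall j, A j (v 0 j)].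
Proof.
move=> mA; rewrite (_ : mkset _ =
    \bigcap_(j : 'I_d) ((fun v : 'rV[R]_d => v 0 j) @^-1` A j)).
  apply: fin_bigcap_measurable => // j _.
  by rewrite -[X in measurable X]setTI; exact: measurable_coord.
by apply/seteqP; split => v /= Av j; [move=> _|]; exact: Av.
Qed.

Lemma lebesgue_rV_subproof d :
  exists2 mu : {sigma_finite_measure set 'rV[R]_d -> \bar R},
    mu = @lebesgue_rV R d :> (set 'rV[R]_d -> \bar R) &
    forall A : 'I_d -> set (measurableTypeR R), (forall j, measurable (A j)) ->
      mu [set v | forall j, A j (v 0 j)] =
      (\prod_(j < d) lebesgue_measure (A j))%E.
Proof.
elim: d => [|d [mu muE muX]].
  exists (\d_(0 : 'rV[R]_0)) => // A _.
  by rewrite big_ord0 /= diracE mem_set// => -[].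
pose P : {measure set (measurableTypeR R * 'rV[R]_d) -> \bar R} :=
  (@lebesgue_measure R \x mu)%E.
pose nu : {measure set 'rV[R]_d.+1 -> \bar R} :=
  measure_function_pushforward__canonical__measure_function_Measure P
    (@measurable_rV_cons d).
have nuX (A : 'I_d.+1 -> set (measurableTypeR R)) :
    (forall j, measurable (A j)) ->
    nu [set v | forall j, A j (v 0 j)] =
    (\prod_(j < d.+1) lebesgue_measure (A j))%E.
  move=> mA; rewrite big_ord_recl -(muX (fun j => A (lift ord0 j)))//.
  have mB : measurable [set v : 'rV[R]_d | forall j, A (lift ord0 j) (v 0 j)].
    by apply: (measurable_rV_box (A := fun j => A (lift ord0 j))) => j.
  rewrite -(product_measure1E _ mu)//.
  rewrite /nu /= /pushforward; congr (_ _); apply/seteqP; split => -[x v] /=.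
    move=> Av; split => [|j]; first by have := Av ord0; rewrite rV_cons0.
    by have := Av (lift ord0 j); rewrite rV_consS.
  move=> [Ax Av] j; have [k ->|->] := unliftP ord0 j; last by rewrite rV_cons0.
  by rewrite rV_consS.
have nufin : sigma_finite setT nu.
  exists (fun k => [set v : 'rV[R]_d.+1 | forall j, `]- (k%:R), k%:R]%classic (v 0 j)]).
    apply/seteqP; split => // v _.
    exists (Num.truncn `|v|).+1 => // j /=.
    have vj : `|v 0 j| < (Num.truncn `|v|).+1%:R.
      apply: (le_lt_trans _ (truncnS_gt _)).
      rewrite [leRHS]/Num.norm /= mx_normrE.
      exact: (le_bigmax _ (fun i : 'I_1 * 'I_d.+1 => `|v i.1 i.2|) (0, j)).
    by rewrite in_itv /=; move: vj; rewrite ltr_norml => /andP[-> /ltW].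
  move=> k; pose I : set R := `]- (k%:R), k%:R]%classic.
  have mI (j : 'I_d.+1) : measurable I by exact: measurable_itv.
  split; first exact: (measurable_rV_box mI).
  rewrite (nuX _ mI).
  suff /andP[] : (0 <= \prod_(j < d.+1) lebesgue_measure I < +oo)%E by [].
  apply: (big_ind (fun x : \bar R => (0 <= x < +oo)%E)) => [|x y|j _].
  - by rewrite lee01 ltry.
  - move=> /andP[x0 xoo] /andP[y0 yoo].
    by rewrite mule_ge0//= lte_mul_pinfty// ge0_fin_numE.
  - rewrite measure_ge0/= lebesgue_measure_itv /=.
    by case: ifP => // _; rewrite -EFinB ltry.
pose nu' := HB.pack_for {sigma_finite_measure set 'rV[R]_d.+1 -> \bar R}
  (Measure.sort nu) (Measure_isSigmaFinite.Build _ _ _ nu nufin).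
exists nu' => //=.
by rewrite /nu' /= /nu /= /P/= muE.
Qed.

Section lebesgue_rV_measure.
Variable d : nat.

Let lebesgue_rV0 : @lebesgue_rV R d set0 = 0%E.
Proof. by have [mu <- _] := lebesgue_rV_subproof d; exact: measure0. Qed.

Let lebesgue_rV_ge0 A : (0 <= @lebesgue_rV R d A)%E.
Proof. by have [mu <- _] := lebesgue_rV_subproof d; exact: measure_ge0. Qed.

Let lebesgue_rV_sigma_additive : semi_sigma_additive (@lebesgue_rV R d).
Proof.
have [mu <- _] := lebesgue_rV_subproof d.
exact: measure_semi_sigma_additive.
Qed.

HB.instance Definition _ := isMeasure.Build _ _ _ (@lebesgue_rV R d)
  lebesgue_rV0 lebesgue_rV_ge0 lebesgue_rV_sigma_additive.

Let lebesgue_rV_sigma_finite : sigma_finite setT (@lebesgue_rV R d).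
Proof. by have [mu <- _] := lebesgue_rV_subproof d; exact: sigma_finiteT. Qed.

HB.instance Definition _ := Measure_isSigmaFinite.Build _ _ _ (@lebesgue_rV R d)
  lebesgue_rV_sigma_finite.

Lemma lebesgue_rV_box (A : 'I_d -> set (measurableTypeR R)) :
  (forall j, measurable (A j)) ->
  lebesgue_rV [set v | forall j, A j (v 0 j)] =
  (\prod_(j < d) lebesgue_measure (A j))%E.
Proof. by have [mu <- muX] := lebesgue_rV_subproof d; exact: muX. Qed.

End lebesgue_rV_measure.
End rV_Borel.

Definition translation_invariant (R : realType) (d : nat)
    (mu : set 'rV[R]_d -> \bar R) : Prop :=
  forall (B : set 'rV[R]_d) (x : 'rV[R]_d), measurable B ->
    mu [set y + x | y in B] = mu B.

Definition unit_cube (R : realType) (d : nat) : set 'rV[R]_d :=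
  [set v | forall i, 0 <= v 0 i <= 1].

(* Main.v *)
(* Keep the Lebesgue measure on the sets whose projection to the first coordinate
   is meagre in R, and give every other set the value +oo. The sets of the first
   kind form a translation invariant sigma-ideal, so this is a translation
   invariant measure. By the Baire category theorem the unit cube is not in the
   ideal. A compact set in the ideal with positive Lebesgue measure is K = A^d,
   where A is [0, 1] minus an open set of measure < 1 containing the rationals. *)
Require Import Defs.
From HB Require Import structures.
From mathcomp Require Import all_boot all_order all_algebra.
From mathcomp Require Import all_classical all_reals all_analysis.
From mathcomp Require Import measurable_realfun.

Import Order.TTheory GRing.Theory Num.Theory.
Import numFieldNormedType.Exports.

Local Open Scope classical_set_scope.
Local Open Scope ring_scope.

Lemma measurable_addr (R : realType) (a : R) :
  measurable_fun setT ((fun x => x + a) : measurableTypeR R -> measurableTypeR R).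
Proof. by apply: measurable_funD => //; exact: measurable_cst. Qed.

Lemma measurable_rV_addr (R : realType) (d : nat) (a : 'rV[R]_d) :
  measurable_fun setT (fun v : 'rV[R]_d => v + a).
Proof.
apply: measurable_fun_rV => j; under eq_fun do rewrite mxE.
by apply: measurable_funD; [exact: measurable_coord|exact: measurable_cst].
Qed.

(** The pushforward of the Lebesgue measure along the translation gives every half-open interval its
    length, so uniqueness applies. *)
Lemma lebesgue_measureDr (R : realType) (a : R) (A : set (measurableTypeR R)) :
  measurable A -> lebesgue_measure ((fun x => x + a) @^-1` A) = lebesgue_measure A.
Proof.
move=> mA.
pose m : {measure set (measurableTypeR R) -> \bar R} :=
  measure_function_pushforward__canonical__measure_function_Measure
    (@lebesgue_measure R) (measurable_addr _ a).
rewrite [RHS](lebesgue_measure_unique (mu := m))// => _ [[b c]] _ <-.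
rewrite /m/= /pushforward (_ : _ @^-1` _ = `]b - a, c - a]%classic); last first.
  by apply/seteqP; split => x /=; rewrite !in_itv/= ltrBlDr lerBrDr.
rewrite !lebesgue_measure_itv/= !lte_fin ltrD2r.
by rewrite -!EFinB opprB addrA subrK.
Qed.

(** By induction on [d]: along [rV_cons], translation by [x] becomes the map [s], which shifts each
    factor of the product. The pushforward of the product measure along [s] has the right value on
    rectangles, by the one-dimensional case and the induction hypothesis, so it is the product
    measure itself. *)
Lemma lebesgue_rVDr (R : realType) (d : nat) (x : 'rV[R]_d) (B : set 'rV[R]_d) :
  measurable B -> lebesgue_rV ((fun v => v + x) @^-1` B) = lebesgue_rV B.
Proof.
elim: d x B => [|d IH] x B mB.
  congr lebesgue_rV; apply/seteqP.
  by split => v /=; rewrite [v + x]thinmx0 [v]thinmx0.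
pose y : 'rV[R]_d := \row_j x 0 (lift ord0 j).
pose s (p : measurableTypeR R * 'rV[R]_d) : measurableTypeR R * 'rV[R]_d :=
  (p.1 + x 0 ord0, p.2 + y).
have ms : measurable_fun setT s.
  apply/measurable_fun_pairP; split => /=.
    exact: measurableT_comp (measurable_addr _ _) measurable_fst.
  exact: measurableT_comp (measurable_rV_addr _ _ _) measurable_snd.
pose m : {measure set (measurableTypeR R * 'rV[R]_d) -> \bar R} :=
  measure_function_pushforward__canonical__measure_function_Measure
    (@lebesgue_measure R \x @lebesgue_rV R d)%E ms.
have mcB : measurable (@rV_cons R d @^-1` B).
  by rewrite -[X in measurable X]setTI; exact: measurable_rV_cons.
rewrite /= /pushforward (@product_measure_unique _ _ _ _ _ _ _ m _ _ mcB).
  rewrite /m /= /pushforward; congr (_ _); apply/seteqP.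
  suff E p : rV_cons p + x = rV_cons (s p) by split => p /=; rewrite E.
  apply/rowP => j; have [k ->|->] := unliftP ord0 j.
    by rewrite mxE !rV_consS !mxE.
  by rewrite mxE !rV_cons0.
move=> A C mA mC.
transitivity (lebesgue_measure ((fun z => z + x 0 ord0)%R @^-1` A) *
    lebesgue_rV ((fun v => v + y)%R @^-1` C))%E.
  apply: product_measure1E; rewrite -[X in measurable X]setTI.
    exact: measurable_addr.
  exact: measurable_rV_addr.
by congr (_ * _)%E; [exact: lebesgue_measureDr|exact: IH].
Qed.

(** Stated through complements: the complements of the [F n] are closed, nowhere dense and cover
    [A]. In this form [Baire] applies directly. *)
Definition meagre {T : topologicalType} (A : set T) :=
  exists2 F : (set T)^nat,
    (forall n, open (F n) /\ dense (F n)) & A `&` \bigcap_n F n = set0.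

Lemma meagre_sub (T : topologicalType) (A B : set T) :
  A `<=` B -> meagre B -> meagre A.
Proof.
move=> AB [F oF B0]; exists F => //; rewrite -subset0 => x [/AB Bx Fx].
by rewrite -B0.
Qed.

Lemma meagre_bigcup (T : topologicalType) (A : (set T)^nat) :
  (forall n, meagre (A n)) -> meagre (\bigcup_n A n).
Proof.
move=> /(_ _)/cid2-/all_sig2[F oF A0].
(* The double family [F i j] becomes one sequence through a coding of pairs; an index that codes no
   pair gets [setT], which is open and dense. *)
pose G k := if unpickle k is Some (i, j) then F i j else setT.
exists G => [k|]; last first.
  rewrite -subset0 => x [[n _ Anx] Gx]; rewrite -(A0 n); split => // j _.
  by have := Gx (pickle (n, j)) I; rewrite /G pickleK.
rewrite /G; case: unpickle => [[i j]|]; first exact: oF.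
by split; [exact: openT|move=> O [z Oz] _; exists z].
Qed.

(** Translation is a homeomorphism, so it pulls dense open sets back to dense open sets. *)
Lemma meagre_shift (R : realType) (a : R) (A : set R) :
  meagre A -> meagre ((fun x => x + a) @^-1` A).
Proof.
have cs (c : R) : continuous (fun x : R => x + c).
  by move=> x; apply: cvgD; [exact: cvg_id|exact: cvg_cst].
move=> [F oF A0]; exists (fun n => (fun x => x + a) @^-1` F n) => [n|].
  split; first by apply: open_comp (oF n).1 => x _; exact: cs.
  move=> O [z Oz] oO; have [||y []] := (oF n).2 ((fun x => x - a) @^-1` O).
  - by exists (z + a); rewrite /= addrK.
  - by apply: open_comp oO => x _; exact: cs.
  by move=> Oy Fy; exists (y - a); split => //=; rewrite subrK.
rewrite -subset0 => x [Axa Fxa]; suff : set0 (x + a) by [].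
by rewrite -A0; split=> // n _; exact: Fxa.
Qed.

Lemma closed_meagre (T : topologicalType) (A : set T) :
  closed A -> dense (~` A) -> meagre A.
Proof.
move=> cA dA; exists (fun=> ~` A) => [_|]; first by split => //; exact: closed_openC.
by rewrite -subset0 => x [Ax /(_ 0%N I)].
Qed.

(** By Baire, the intersection of the [F n] is dense and so meets the open interval. *)
Lemma not_meagre_itv (R : realType) (a b : R) : a < b -> ~ meagre `[a, b]%classic.
Proof.
move=> ab [F oF F0].
have [||x [xab Fx]] := Baire oF (O := `]a, b[%classic).
- by exists ((a + b) / 2); rewrite /= in_itv/= !midf_lt.
- exact: interval_open.
have : set0 x by rewrite -F0; split => //; exact: subset_itv_oo_cc.
by [].
Qed.

Lemma meagre_compact_pos (R : realType) : exists A : set R,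
  [/\ compact A, A `<=` `[0, 1], meagre A & (0 < lebesgue_measure A)%E].
Proof.
pose Q : set R := range ratr.
have mQ : measurable Q.
  apply: countable_measurable => [q|]; first exact: measurable_set1.
  exact: sub_countable (card_image_le _ _) (countableP _).
have Qoo : (lebesgue_measure Q < +oo)%E by rewrite lebesgue_measure_rat ltry.
(* Outer regularity with tolerance 1 bounds the measure of [U] minus [Q]; since [Q] is null, the
   bound passes to [U]. *)
have [U [oU QU UQ]] := lebesgue_regularity_outer mQ Qoo ltr01.
have mU : measurable U by exact: open_measurable.
have U1 : (lebesgue_measure U < 1)%E.
  rewrite -(setDUK QU); apply: le_lt_trans (measureU2 _ _ _) _ => //.
    exact: measurableD.
  by rewrite [X in (X + _)%E]lebesgue_measure_rat add0e.
exists (`[0, 1] `\` U); split.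
- apply: (subclosed_compact _ (@segment_compact R 0 1)) => //.
  by apply: closedI; [exact: interval_closed|exact: open_closedC].
- exact: subDsetl.
- apply: closed_meagre.
    by apply: closedI; [exact: interval_closed|exact: open_closedC].
  (* The complement is dense because it contains the rationals. *)
  move=> O O0 oO; have [q [Oq Qq]] := dense_rat O0 oO.
  by exists q; split => // -[_]; apply; exact: QU.
- have mI : measurable (`[0, 1]%classic : set (measurableTypeR R)) by [].
  rewrite measureD//=; last by rewrite lebesgue_measure_itv/= lte01 -EFinB ltry.
  rewrite [X in (X - _)%E]lebesgue_measure_itv/= lte01 oppr0 adde0 sube_gt0.
  by rewrite (le_lt_trans _ U1)// le_measure ?inE//; exact: measurableI.
Qed.

(** If all [A n] lie in the sigma-ideal, so does their union, and additivity is that of [m].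
    Otherwise some [A n] has value [+oo], and the union, being larger, is outside the ideal too. *)
Lemma ideal_measure (dT : measure_display) (T : measurableType dT) (R : realType)
    (m : {measure set T -> \bar R}) (I : set (set T)) :
  I set0 -> (forall A B, A `<=` B -> I B -> I A) ->
  (forall A : (set T)^nat, (forall n, I (A n)) -> I (\bigcup_n A n)) ->
  exists mu : {measure set T -> \bar R},
    forall A, mu A = (if `[< I A >] then m A else +oo)%E.
Proof.
move=> I0 Isub Icup.
pose f A : \bar R := (if `[< I A >] then m A else +oo)%E.
have f0 : f set0 = 0%E by rewrite /f asboolT// measure0.
have f_ge0 A : (0 <= f A)%E by rewrite /f; case: ifP.
have f_sadd : semi_sigma_additive f.
  move=> A mA tA mUA; have [IA|/existsNP[n nIA]] := pselect (forall n, I (A n)).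
    rewrite {2}/f asboolT; last exact: Icup.
    under eq_fun do under eq_bigr do rewrite /f asboolT//.
    exact: measure_semi_sigma_additive.
  rewrite {2}/f asboolF; last by apply: contra_not nIA; exact/Isub/bigcup_sup.
  (* The partial sums equal [+oo] as soon as they include the index [n]. *)
  apply: cvg_near_cst; near=> k; apply/esum_eqyP.
    by move=> i _; rewrite gt_eqF// (lt_le_trans _ (f_ge0 _))// ltNy0.
  exists n; split=> //; last by rewrite /f asboolF.
  by rewrite mem_index_iota/=; near: k; exact: nbhs_infty_gt.
by exists (HB.pack_for {measure set T -> \bar R} f
  (isMeasure.Build _ _ _ f f0 f_ge0 f_sadd)).
Unshelve. all: by end_near.
Qed.

Theorem theorem1 (R : realType) (d : nat) (hd : (1 <= d)%N) :
  exists mu : {measure set 'rV[R]_d -> \bar R},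
    [/\ translation_invariant mu,
        ~ (forall B : set 'rV[R]_d, measurable B -> mu B = lebesgue_rV B),
        exists K : set 'rV[R]_d,
          [/\ compact K, (0 < mu K)%E, mu K = lebesgue_rV K
            & (lebesgue_rV K < +oo)%E]
      & mu (@unit_cube R d) = +oo%E].
Proof.
pose j0 : 'I_d := Ordinal hd.
pose I (B : set 'rV[R]_d) := meagre [set v 0 j0 | v in B].
have [|A B AB|A IA|mu muE] := @ideal_measure _ _ _ (@lebesgue_rV R d) I.
- rewrite /I image_set0; apply: closed_meagre; first exact: closed0.
  by rewrite setC0 => O [z Oz] _; exists z.
- by apply: meagre_sub; exact: image_subset.
- by rewrite /I image_bigcup; exact: meagre_bigcup.
have cubeE : @unit_cube R d =
    [set v | forall j, (fun=> `[0, 1]%classic : set (measurableTypeR R)) j (v 0 j)].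
  by apply/seteqP; split => v /= v01 j; have := v01 j; rewrite in_itv.
have leb_cube : lebesgue_rV (@unit_cube R d) = 1%E.
  rewrite cubeE [LHS](@lebesgue_rV_box R d (fun=> `[0, 1]%classic))// big1// => j _.
  by rewrite lebesgue_measure_itv/= lte01 oppr0 adde0.
have mu_cube : mu (@unit_cube R d) = +oo%E.
  rewrite muE asboolF// => I01; apply: (@not_meagre_itv R 0 1 ltr01).
  (* Constant vectors show that the projection of the cube contains [[0, 1]]. *)
  apply: meagre_sub I01 => x /=; rewrite in_itv/= => x01.
  by exists (const_mx x) => [i|]; rewrite mxE.
exists mu; split => //.
- move=> B x mB.
  have -> : [set y + x | y in B] = (fun v => v + - x) @^-1` B.
    apply/seteqP; split => [_ [y By <-]|v Bv] /=; first by rewrite addrK.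
    by exists (v - x) => //; rewrite subrK.
  rewrite !muE; congr (if _ then _ else _); last exact: lebesgue_rVDr.
  apply/asbool_equiv_eq.
  (* The projection of a translate lies in the translate of the projection by [a 0 j0]. The converse
     implication needed below comes from shifting back by [x]. *)
  have shiftI (C : set 'rV[R]_d) a : I C -> I ((fun v => v + a) @^-1` C).
    move=> /(@meagre_shift R (a 0 j0)); apply: meagre_sub => _ [v Cv <-].
    by exists (v + a) => //; rewrite mxE.
  split; last exact: shiftI.
  move=> /shiftI-/(_ x); apply: meagre_sub; apply: image_subset => v Bv /=.
  by rewrite addrK.
(* The unit cube separates the two measures: [+oo] against 1. *)
- move=> /(_ (@unit_cube R d)); rewrite mu_cube leb_cube; apply/not_implyP.
  split => //; rewrite cubeE.
  exact: (measurable_rV_box (A := fun=> `[0, 1]%classic)).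
- have [A [cA A01 mA A0]] := meagre_compact_pos R.
  have measA : measurable (A : set (measurableTypeR R)).
    by apply: closed_measurable; exact: compact_closed.
  pose K : set 'rV[R]_d := [set v | forall j, A (v 0 j)].
  have KE : lebesgue_rV K = (\prod_(j < d) lebesgue_measure A)%E.
    exact: (lebesgue_rV_box (A := fun=> A)).
  have muK : mu K = lebesgue_rV K.
    (* [K] is in the ideal because its projection lies in the meagre set [A]. *)
    rewrite muE asboolT//; apply: meagre_sub mA => _ [v Kv <-]; exact: Kv.
  exists K; split => //.
  + exact: (@rV_compact _ _ (fun=> A)).
  + by rewrite muK KE; apply: (big_ind (fun z => 0 < z)%E) => // *; rewrite mule_gt0.
  (* [K] is contained in the unit cube, which has Lebesgue measure 1. *)
  + apply: (@le_lt_trans _ _ 1%E); last exact: ltry.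
    rewrite -leb_cube le_measure ?inE//.
    * exact: (measurable_rV_box (A := fun=> A)).
    * rewrite cubeE.
      exact: (measurable_rV_box (A := fun=> `[0, 1]%classic)).
    * by move=> v Kv j; have := A01 _ (Kv j); rewrite /= in_itv.
Qed.
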